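(* Let $y$ be a Vigenère ciphertext obtained with a key of length $m$, containing all the characters of an alphabet $\mathscr{A}$ of a natural language, each with frequency greater than $1$ in $y$, and let $y_1,y_2,\dots,y_m$ be its corresponding lists. Let $\Lambda_{\mathfrak{C}}$ be the Brauer configuration algebra induced by $y$, i.e. the algebra of the Brauer configuration $\mathfrak{C}$ with vertex set $\mathscr{A}$, polygons $y_1,\dots,y_m$, multiplicity function $\mu(j)=1$ for every $j\in\mathscr{A}$, and successor sequences given by $y_1<y_2<\dots<y_m$. If $f_{i,j}$ denotes the frequency of the $j$th alphabetic character in the list $y_i$, then the center $Z(\Lambda_{\mathfrak{C}})$ satisfies $$\dim_k Z(\Lambda_{\mathfrak{C}})=1+m+\sum_{i=1}^{m}\ \sum_{j\in\mathscr{A}}(f_{i,j}-1).$$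
   Context: $k$ is a field. Vigenère lists. In the Vigenère cryptosystem with key $K=(k_1,\dots,k_m)$ over an alphabet identified with $\mathbb{Z}_n$, blocks $(p_1,\dots,p_m)$ of plaintext are encrypted as $(p_1+k_1,\dots,p_m+k_m)\bmod n$. For a ciphertext $y$, the list $y_i$ ($1\le i\le m$) consists of the letters of $y$ in positions congruent to $i$ modulo $m$ (the letters encrypted with $k_i$). Each list is regarded as a multiset of letters. Brauer configuration. A Brauer configuration consists of a finite set of vertices, a finite (indexed) collection of finite multisets of vertices (polygons), each with more than one element counted with multiplicity and every vertex lying in some polygon, a multiplicity function $\mu$ from vertices to positive integers, and an orientation. The valency $val(v)$ of a vertex $v$ is the sum over all polygons of the number of occurrences of $v$ in the polygon. If the polygons are linearly ordered $U_1<\dots<U_m$, the successor sequence of $v$ is the list of polygons containing $v$ in this order, where $U_i$ is repeated (as consecutive distinct copies) as many times as $v$ occurs in $U_i$; the orientation makes this list into a circular order by declaring the first term to follow the last one. Brauer quiver. The Brauer quiver $Q$ has one vertex for each polygon, and for each vertex $v$ of the configuration and each pair of consecutive terms $U<U'$ in the circular order of $v$ (including the step from the last term to the first) one arrow $U\to U'$. The cycles $C_v$ in $Q$ defined by running once through the circular order of a vertex $v$ are called special cycles. Brauer configuration algebra. It is $kQ/I$ where $I$ is generated by: (1) $C_v^{\mu(v)}-C_w^{\mu(w)}$ if $v$ and $w$ are vertices in the same polygon, where $C_v$, $C_w$ are special cycles of $v$ and $w$ at that polygon; (2) $C_v^{\mu(v)}a$ if $a$ is the first arrow of a special cycle $C_v$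 associated with a vertex $v$; (3) $ab$ if $a,b$ are arrows of different special cycles and $ab$ is an element of the path algebra $kQ$.
   Formalization: The formula fails if m = 1 or if some letter is missing from some list (m = 1 with two letters of frequency 2 gives dimension 6, not 4), so the formal theorem also assumes m > 1 and that every letter of the alphabet occurs in every list y_i. *)

(* Defs.v *)
From HB Require Import structures.
From mathcomp Require Import all_boot all_algebra.
From mathcomp Require Import generic_quotient ring_quotient.
From mathcomp Require Import finmap multiset monalg boolp.

Set Implicit Arguments.
Unset Strict Implicit.
Unset Printing Implicit Defensive.

Import GRing.Theory.
Local Open Scope ring_scope.

Record quiver := Quiver {
  qvert : finType;
  qarrow : finType;
  qsrc : qarrow -> qvert;
  qtgt : qarrow -> qvert
}.

Section Paths.
Variable Q : quiver.
Implicit Types (u v : qvert Q) (s t : seq (qarrow Q)).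

Fixpoint is_walk v s : bool :=
  if s is a :: s' then (qsrc a == v) && is_walk (qtgt a) s' else true.

Definition walk_end v s : qvert Q := last v [seq qtgt a | a <- s].

(* A start vertex together with the arrows in the order in which they are
   traversed; (v, [::]) is the trivial path at v. *)
Record qpath := QPath {
  qpath_val : qvert Q * seq (qarrow Q);
  _ : is_walk qpath_val.1 qpath_val.2
}.

HB.instance Definition _ := [isSub for qpath_val].
HB.instance Definition _ := [Choice of qpath by <:].

Implicit Types p q r : qpath.

Definition psrc p : qvert Q := (val p).1.
Definition ptgt p : qvert Q := walk_end (val p).1 (val p).2.

(* [pcomp p q] is the path "first p, then q". *)
Definition pcomp p q : option qpath :=
  if ptgt p == psrc q then insub (psrc p, (val p).2 ++ (val q).2) else None.

Definition ptriv v : qpath := @QPath (v, [::]) isT.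

Lemma is_walk_arrow (a : qarrow Q) : is_walk (qsrc a) [:: a].
Proof. by rewrite /= eqxx. Qed.

Definition parrow (a : qarrow Q) : qpath := @QPath (qsrc a, [:: a]) (is_walk_arrow a).

Lemma is_walk_cat v s t :
  is_walk v (s ++ t) = is_walk v s && is_walk (walk_end v s) t.
Proof.
elim: s v => [|a s IHs] v //=.
by rewrite IHs andbA.
Qed.

Lemma walk_end_cat v s t : walk_end v (s ++ t) = walk_end (walk_end v s) t.
Proof. by rewrite /walk_end map_cat last_cat. Qed.

Lemma pcomp_spec p q :
  ptgt p = psrc q ->
  exists2 r, pcomp p q = Some r & val r = (psrc p, (val p).2 ++ (val q).2).
Proof.
move=> pq; rewrite /pcomp pq eqxx.
have w : is_walk (psrc p, (val p).2 ++ (val q).2).1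
                 (psrc p, (val p).2 ++ (val q).2).2.
  rewrite /= is_walk_cat (valP p) /=.
  by move: pq; rewrite /ptgt /psrc => ->; exact: (valP q).
by exists (QPath w) => //; rewrite (insubT (fun x => is_walk x.1 x.2) w).
Qed.

Lemma pcompN p q : ptgt p != psrc q -> pcomp p q = None.
Proof. by rewrite /pcomp => /negbTE ->. Qed.

Lemma pcompA p q r :
  obind (pcomp^~ r) (pcomp p q) = obind (pcomp p) (pcomp q r).
Proof.
have [pq|npq] := eqVneq (ptgt p) (psrc q); last first.
  rewrite pcompN //=.
  have [qr|nqr] := eqVneq (ptgt q) (psrc r); last by rewrite pcompN.
  have [s -> sE] /= := pcomp_spec qr.
  by rewrite pcompN // /psrc sE.
have [s -> sE] /= := pcomp_spec pq.
have send : ptgt s = ptgt q.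
  rewrite /ptgt sE /= walk_end_cat.
  by move: pq; rewrite /ptgt /psrc => ->.
have [qr|nqr] := eqVneq (ptgt q) (psrc r); last first.
  by rewrite !pcompN // send.
have [t -> tE] /= := pcomp_spec qr.
have [|a -> aE] := @pcomp_spec s r; first by rewrite send.
have [|b -> bE] := @pcomp_spec p t; first by rewrite {1}/psrc tE.
congr Some; apply: val_inj; rewrite aE bE tE sE /=.
by rewrite /psrc sE /= catA.
Qed.

Lemma pcomp1p v p : pcomp (ptriv v) p = if v == psrc p then Some p else None.
Proof.
have [vp|nvp] := eqVneq v (psrc p); last by rewrite pcompN.
have [r -> rE] := @pcomp_spec (ptriv v) p vp.
congr Some; apply: val_inj; rewrite rE /= /psrc /= vp.
by case: p {vp rE} => -[].
Qed.

Lemma pcompp1 v p : pcomp p (ptriv v) = if v == ptgt p then Some p else None.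
Proof.
have [vp|nvp] := eqVneq v (ptgt p); last by rewrite pcompN // eq_sym.
have [r -> rE] := @pcomp_spec p (ptriv v) (esym vp).
congr Some; apply: val_inj; rewrite rE /= cats0 /psrc.
by case: p {vp rE} => -[].
Qed.

End Paths.

Definition path_algebra (k : fieldType) (Q : quiver) : Type := {malg k[qpath Q]}.
HB.instance Definition _ k Q := GRing.Lmodule.on (path_algebra k Q).

HB.lock Definition pa_path (k : fieldType) (Q : quiver) (p : qpath Q)
    : path_algebra k Q := << p >>.

Definition pa_opath (k : fieldType) (Q : quiver) (o : option (qpath Q))
    : path_algebra k Q := oapp (@pa_path k Q) 0 o.

HB.lock Definition pa_mul (k : fieldType) (Q : quiver) (f g : path_algebra k Q)
    : path_algebra k Q :=
  \sum_(p <- msupp f) \sum_(q <- msupp g)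
    (f@_p * g@_q) *: pa_opath k (pcomp p q).

(* The linear map sending each path p to F p. *)
HB.lock Definition lext (k : fieldType) (Q : quiver)
    (F : qpath Q -> path_algebra k Q) (f : path_algebra k Q) : path_algebra k Q :=
  \sum_(p <- msupp f) f@_p *: F p.

Section PathAlgebra.
Variables (k : fieldType) (Q : quiver).
Local Notation path_algebra := (path_algebra k Q).
Local Notation pa_path := (@pa_path k Q).
Local Notation pa_opath := (@pa_opath k Q).
Local Notation pa_mul := (@pa_mul k Q).
Local Notation lext := (@lext k Q).

Implicit Types (f g h : path_algebra) (p q r : qpath Q).

Definition pa_one : path_algebra := \sum_(v : qvert Q) pa_path (ptriv v).

Lemma lextE F f : lext F f = \sum_(p <- msupp f) f@_p *: F p.
Proof. by rewrite lext.unlock. Qed.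

Lemma lextw F (d : {fset qpath Q}) f : (msupp f `<=` d)%fset ->
  lext F f = \sum_(p <- d) f@_p *: F p.
Proof.
move=> le; rewrite lext.unlock (big_fset_incl _ le) //= => p _ /mcoeff_outdom ->.
by rewrite scale0r.
Qed.

Lemma lextD F f g : lext F (f + g) = lext F f + lext F g.
Proof.
rewrite (lextw _ (msuppD_le f g)).
rewrite (lextw _ (fsubsetUl (msupp f) (msupp g))).
rewrite (lextw _ (fsubsetUr (msupp f) (msupp g))) -big_split /=.
by apply: eq_bigr => p _; rewrite mcoeffD scalerDl.
Qed.

Lemma lextZ F c f : lext F (c *: f) = c *: lext F f.
Proof.
rewrite (lextw _ (msuppZ_le c f)) lext.unlock scaler_sumr.
by apply: eq_bigr => p _; rewrite mcoeffZ scalerA.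
Qed.

Lemma lext0 F : lext F 0 = 0.
Proof. by rewrite lext.unlock msupp0 big_seq_fset0. Qed.

Lemma lextU F p : lext F (pa_path p) = F p.
Proof. 
rewrite (@lextw _ [fset p]%fset) ?big_seq_fset1 pa_path.unlock ?mcoeffUU ?scale1r //.
exact: msuppU_le. Qed.

Lemma lext_sum F (I : Type) (s : seq I) (G : I -> path_algebra) :
  lext F (\sum_(i <- s) G i) = \sum_(i <- s) lext F (G i).
Proof. exact: (big_morph (lext F) (lextD F) (lext0 F)). Qed.

Lemma pa_expand f : f = \sum_(p <- msupp f) f@_p *: pa_path p.
Proof.
rewrite [LHS]monalgE; apply: eq_bigr => p _.
apply/malgP => q; rewrite (mcoeffU p f@_p q) (mcoeffZ f@_p (pa_path p) q).
by rewrite pa_path.unlock (mcoeffU p 1 q) mulr_natr.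
Qed.

Lemma lext_comp F G f :
  lext F (lext G f) = lext (fun p => lext F (G p)) f.
Proof.
rewrite (lextE G f) (lextE _ f) lext_sum.
by apply: eq_bigr => p _; rewrite lextZ.
Qed.

Lemma eq_lext F G f : F =1 G -> lext F f = lext G f.
Proof. by move=> FG; rewrite lext.unlock; apply: eq_bigr => p _; rewrite FG. Qed.

Lemma lext_id f : lext pa_path f = f.
Proof. by rewrite [RHS]pa_expand lext.unlock. Qed.

Lemma pa_mulE f g :
  pa_mul f g = lext (fun p => lext (fun q => pa_opath (pcomp p q)) g) f.
Proof.
rewrite pa_mul.unlock lextE; apply: eq_bigr => p _; rewrite lextE scaler_sumr.
by apply: eq_bigr => q _; rewrite scalerA.
Qed.

Lemma lextFD F G f : lext (fun p => F p + G p) f = lext F f + lext G f.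
Proof. by rewrite lext.unlock -big_split; apply: eq_bigr => p _; rewrite scalerDr. Qed.

Lemma lextFZ c F f : lext (fun p => c *: F p) f = c *: lext F f.
Proof.
rewrite lext.unlock scaler_sumr; apply: eq_bigr => p _.
by rewrite !scalerA mulrC.
Qed.

Lemma lextF0 f : lext (fun=> 0) f = 0.
Proof. by rewrite lext.unlock big1 // => p _; rewrite scaler0. Qed.

Lemma lext_exch (F : qpath Q -> qpath Q -> path_algebra) f g :
  lext (fun p => lext (F p) g) f = lext (fun q => lext (F^~ q) f) g.
Proof.
rewrite [LHS]lextE.
transitivity (\sum_(p <- msupp f) \sum_(q <- msupp g) f@_p *: (g@_q *: F p q)).
  by apply: eq_bigr => p _; rewrite lextE scaler_sumr.
rewrite [RHS]lextE exchange_big; apply: eq_bigr => q _.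
rewrite lextE scaler_sumr; apply: eq_bigr => p _.
by rewrite (scalerA f@_p) (scalerA g@_q) (mulrC f@_p).
Qed.

Lemma pa_mulDl : left_distributive pa_mul +%R.
Proof. by move=> f g h; rewrite !pa_mulE lextD. Qed.

Lemma pa_mulDr : right_distributive pa_mul +%R.
Proof.
move=> f g h; rewrite !pa_mulE -lextFD.
by apply: eq_lext => p; rewrite lextD.
Qed.

Lemma pa_scaleAl c f g : c *: pa_mul f g = pa_mul (c *: f) g.
Proof. by rewrite !pa_mulE lextZ. Qed.

Lemma pa_scaleAr c f g : c *: pa_mul f g = pa_mul f (c *: g).
Proof. by rewrite !pa_mulE -lextFZ; apply: eq_lext => p; rewrite lextZ. Qed.

Lemma pa_mul_path p q : pa_mul (pa_path p) (pa_path q) = pa_opath (pcomp p q).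
Proof. by rewrite pa_mulE !lextU. Qed.

Lemma lext_opath F o : lext F (pa_opath o) = oapp F 0 o.
Proof. by case: o => [p|] /=; rewrite ?lextU ?lext0. Qed.

Lemma pa_mulA : associative pa_mul.
Proof.
move=> f g h.
transitivity (lext (fun p => lext (fun q => lext (fun r =>
    pa_opath (obind ((@pcomp Q)^~ r) (pcomp p q))) h) g) f).
  rewrite (pa_mulE f) (pa_mulE g); apply: eq_lext => p.
  apply: etrans (lext_comp _ _ _) _; apply: eq_lext => q.
  apply: etrans (lext_comp _ _ _) _; apply: eq_lext => r.
  by apply: etrans (lext_opath _ _) _; rewrite pcompA; case: (pcomp q r).
rewrite (pa_mulE _ h) (pa_mulE f); symmetry.
apply: etrans (lext_comp _ _ _) _; apply: eq_lext => p.
apply: etrans (lext_comp _ _ _) _; apply: eq_lext => q.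
apply: etrans (lext_opath _ _) _.
by case: (pcomp p q) => [s|] //=; rewrite lextF0.
Qed.

Lemma lext_one F w (r : qpath Q) :
    (forall v, F (ptriv v) = if v == w then pa_path r else 0) ->
  lext F pa_one = pa_path r.
Proof.
move=> hF; rewrite /pa_one lext_sum.
transitivity (\sum_(v : qvert Q) if v == w then pa_path r else 0).
  by apply: eq_bigr => v _; rewrite lextU hF.
by rewrite -big_mkcond /= big_pred1_eq.
Qed.

Lemma pa_mul1 : left_id pa_one pa_mul.
Proof.
move=> f; rewrite pa_mulE lext_exch.
transitivity (lext pa_path f); last exact: lext_id.
apply: eq_lext => q; apply: (lext_one (w := psrc q)) => v.
by rewrite pcomp1p; case: ifP.
Qed.

Lemma pa_mulr1 : right_id pa_one pa_mul.
Proof.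
move=> f; rewrite pa_mulE.
transitivity (lext pa_path f); last exact: lext_id.
apply: eq_lext => q; apply: (lext_one (w := ptgt q)) => v.
by rewrite pcompp1; case: ifP.
Qed.

(* The zero ring is not excluded (it is the path algebra of the empty quiver),
   hence the possibly-zero ring structure; the library's algebra structures
   require 1 != 0, so compatibility with scaling is [pa_scalerAl/Ar] below. *)
HB.instance Definition _ := GRing.Zmodule_isPzRing.Build path_algebra
  pa_mulA pa_mul1 pa_mulr1 pa_mulDl pa_mulDr.

Lemma pa_scalerAl c f g : c *: (f * g) = (c *: f) * g.
Proof. exact: pa_scaleAl. Qed.

Lemma pa_scalerAr c f g : c *: (f * g) = f * (c *: g).
Proof. exact: pa_scaleAr. Qed.

Definition pa_arrow (a : qarrow Q) : path_algebra := pa_path (parrow a).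

End PathAlgebra.

Definition two_sided_ideal (R : pzRingType) (J : R -> Prop) : Prop :=
  [/\ J 0, forall x y, J x -> J y -> J (x - y)
    & forall a x, J x -> J (a * x) /\ J (x * a)].

Definition ideal_gen (R : pzRingType) (G : R -> Prop) (x : R) : Prop :=
  forall J : R -> Prop, two_sided_ideal J -> (forall g, G g -> J g) -> J x.

Lemma ideal_gen_ideal (R : pzRingType) (G : R -> Prop) :
  two_sided_ideal (ideal_gen G).
Proof.
split=> [J [] //|x y Gx Gy J hJ GJ|a x Gx].
  by have [_ + _] := hJ; apply; [apply: Gx|apply: Gy].
by split=> J hJ GJ; have [_ _ /(_ a x (Gx J hJ GJ)) []] := hJ.
Qed.

Section QuotientRing.
Variables (R : pzRingType) (G : R -> Prop).

Definition ideal_pred : {pred R} := fun x => `[< ideal_gen G x >].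

Let ideal_predP x : reflect (ideal_gen G x) (x \in ideal_pred).
Proof. exact: asboolP. Qed.

Let ideal_pred_zmod : zmod_closed ideal_pred.
Proof.
have [h0 hB _] := ideal_gen_ideal G.
split=> [|x y /ideal_predP hx /ideal_predP hy]; apply/ideal_predP => //.
exact: hB.
Qed.

HB.instance Definition _ := GRing.isZmodClosed.Build R ideal_pred ideal_pred_zmod.

(* The quotient of R by the two-sided ideal generated by G. *)
Definition quot_ring : Type := Quotient.quot ideal_pred.
HB.instance Definition _ := GRing.Zmodule.on quot_ring.

Definition quot_pi : R -> quot_ring := \pi_(Quotient.quot ideal_pred)%qT.

Definition quot_one : quot_ring := quot_pi 1.
Definition quot_mul (x y : quot_ring) : quot_ring := quot_pi (repr x * repr y).

Lemma quot_piP x y : quot_pi x = quot_pi y <-> ideal_gen G (x - y).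
Proof.
split=> [|h].
  by move=> /eqP; rewrite -Quotient.idealrBE => /ideal_predP.
by apply/eqP; rewrite -Quotient.idealrBE; apply/ideal_predP.
Qed.

Lemma quot_reprK x : quot_pi (repr x) = x.
Proof. exact: reprK. Qed.

Lemma quot_piD x y : quot_pi (x + y) = quot_pi x + quot_pi y.
Proof. exact: (raddfD \pi_(Quotient.quot ideal_pred)%qT). Qed.

Lemma quot_piM x y : quot_pi (x * y) = quot_mul (quot_pi x) (quot_pi y).
Proof.
have [h0 hB hM] := ideal_gen_ideal G.
have hD u v : ideal_gen G u -> ideal_gen G v -> ideal_gen G (u + v).
  move=> hu hv; rewrite -[v]opprK; apply: (hB) => //.
  by rewrite -sub0r; apply: hB.
apply/quot_piP.
set x' := repr _; set y' := repr _.
have hx : ideal_gen G (x - x') by apply/quot_piP; rewrite quot_reprK.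
have hy : ideal_gen G (y - y') by apply/quot_piP; rewrite quot_reprK.
rewrite -(subrKA (x' * y)) -mulrBl -mulrBr.
by apply: hD; [have [] := hM y _ hx | have [] := hM x' _ hy].
Qed.

Lemma quot_ind (P : quot_ring -> Prop) :
  (forall x, P (quot_pi x)) -> forall x, P x.
Proof. by move=> h x; rewrite -[x]quot_reprK. Qed.

Let quot_mulA : associative quot_mul.
Proof.
elim/quot_ind=> x; elim/quot_ind=> y; elim/quot_ind=> z.
by rewrite -!quot_piM mulrA.
Qed.
Let quot_mul1 : left_id quot_one quot_mul.
Proof. by elim/quot_ind=> x; rewrite -quot_piM mul1r. Qed.
Let quot_mulr1 : right_id quot_one quot_mul.
Proof. by elim/quot_ind=> x; rewrite -quot_piM mulr1. Qed.
Let quot_mulDl : left_distributive quot_mul +%R.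
Proof.
elim/quot_ind=> x; elim/quot_ind=> y; elim/quot_ind=> z.
by rewrite -quot_piD -!quot_piM -quot_piD mulrDl.
Qed.
Let quot_mulDr : right_distributive quot_mul +%R.
Proof.
elim/quot_ind=> x; elim/quot_ind=> y; elim/quot_ind=> z.
by rewrite -quot_piD -!quot_piM -quot_piD mulrDr.
Qed.

HB.instance Definition _ := GRing.Zmodule_isPzRing.Build quot_ring
  quot_mulA quot_mul1 quot_mulr1 quot_mulDl quot_mulDr.

End QuotientRing.

Section QuotientAlgebra.
Variables (k : fieldType) (Q : quiver) (G : path_algebra k Q -> Prop).
Local Notation kQ := (path_algebra k Q).

Definition quot_algebra : Type := quot_ring G.
HB.instance Definition _ := GRing.PzRing.on quot_algebra.

Definition quot_scale (c : k) (x : quot_algebra) : quot_algebra :=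
  quot_pi G (c *: repr x).

Lemma ideal_gen_scale c (x : kQ) : ideal_gen G x -> ideal_gen G (c *: x).
Proof.
have [_ _ hM] := ideal_gen_ideal G => /(hM (c *: (1 : kQ))) [+ _].
by rewrite -(pa_scalerAl c 1 x) mul1r.
Qed.

Lemma quot_piZ c (x : kQ) : quot_pi G (c *: x) = quot_scale c (quot_pi G x).
Proof.
apply/quot_piP.
have hx : ideal_gen G (x - repr (quot_pi G x)) by apply/quot_piP; rewrite quot_reprK.
by have := ideal_gen_scale c hx; rewrite scalerBr.
Qed.

Let quot_scaleA a b x : quot_scale a (quot_scale b x) = quot_scale (a * b) x.
Proof. by elim/quot_ind: x => x; rewrite -!quot_piZ scalerA. Qed.
Let quot_scale1 : left_id 1 quot_scale.
Proof. by elim/quot_ind=> x; rewrite -quot_piZ scale1r. Qed.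
Let quot_scaleDr : right_distributive quot_scale +%R.
Proof.
move=> c; elim/quot_ind=> x; elim/quot_ind=> y.
by rewrite -!quot_piZ -!quot_piD -quot_piZ scalerDr.
Qed.
Let quot_scaleDl x : {morph quot_scale^~ x : a b / a + b}.
Proof. by elim/quot_ind: x => x a b; rewrite -!quot_piZ scalerDl quot_piD. Qed.

HB.instance Definition _ := GRing.Zmodule_isLmodule.Build k quot_algebra
  quot_scaleA quot_scale1 quot_scaleDr quot_scaleDl.

Lemma quot_scalerAl (c : k) (x y : quot_algebra) : c *: (x * y) = (c *: x) * y.
Proof.
elim/quot_ind: x => x; elim/quot_ind: y => y.
transitivity (quot_pi G (c *: (x * y))); first by rewrite quot_piZ quot_piM.
by rewrite pa_scalerAl quot_piM quot_piZ.
Qed.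

Lemma quot_scalerAr (c : k) (x y : quot_algebra) : c *: (x * y) = x * (c *: y).
Proof.
elim/quot_ind: x => x; elim/quot_ind: y => y.
transitivity (quot_pi G (c *: (x * y))); first by rewrite quot_piZ quot_piM.
by rewrite pa_scalerAr quot_piM quot_piZ.
Qed.

End QuotientAlgebra.

(* The polygons form a family indexed by 'I_m, whose order fixes the
   orientation. *)
Record brauer_config := BrauerConfig {
  bc_vertex : finType;
  bc_npoly : nat;
  bc_polygon : 'I_bc_npoly -> {mset bc_vertex}%mset;
  bc_mult : bc_vertex -> nat
}.

Definition is_brauer_config (C : brauer_config) : Prop :=
  [/\ forall i : 'I_(bc_npoly C), (1 < size (bc_polygon i))%N,
      forall v : bc_vertex C, exists i : 'I_(bc_npoly C), v \in bc_polygon i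
    & forall v : bc_vertex C, (0 < bc_mult v)%N].

Section BrauerAlgebra.
Variables (k : fieldType) (C : brauer_config).
Local Notation V := (bc_vertex C).
Local Notation poly_ix := 'I_(bc_npoly C).

Definition valency (v : V) : nat := (\sum_(i < bc_npoly C) bc_polygon i v)%N.

Definition succ_seq (v : V) : seq poly_ix :=
  flatten [seq nseq (bc_polygon i v) i | i <- enum 'I_(bc_npoly C)].

Lemma size_succ_seq v : size (succ_seq v) = valency v.
Proof.
rewrite size_flatten /shape -map_comp sumnE big_map /valency big_enum /=.
by apply: eq_bigr => i _; rewrite size_nseq.
Qed.

(* The arrow (v, t) goes from the t-th term of the successor sequence of v to
   the cyclically next one; so (v, t) also names an occurrence of v. *)
Definition bc_arrow : finType := {v : V & 'I_(size (succ_seq v))}.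

Definition next_arrow (a : bc_arrow) : bc_arrow :=
  Tagged (fun v : V => 'I_(size (succ_seq v))) (ordS (tagged a)).

Definition arrow_src (a : bc_arrow) : poly_ix :=
  tnth (in_tuple (succ_seq (tag a))) (tagged a).

Definition arrow_tgt (a : bc_arrow) : poly_ix := arrow_src (next_arrow a).

Definition brauer_quiver : quiver := Quiver arrow_src arrow_tgt.

Local Notation kQ := (path_algebra k brauer_quiver).

Definition arrow (a : bc_arrow) : kQ := @pa_arrow k brauer_quiver a.

(* The special cycle of the vertex [tag a] whose first arrow is [a], at the
   polygon [arrow_src a].  A vertex occurring several times in a polygon has
   one special cycle there for each occurrence. *)
Definition special_cycle (a : bc_arrow) : kQ :=
  \prod_(b <- traject next_arrow a (valency (tag a))) arrow b.

Definition special_power (a : bc_arrow) : kQ :=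
  special_cycle a ^+ bc_mult (tag a).

(* The products killed by the third relation are the paths ab of length two
   that do not run along a special cycle, where "along" is taken cyclically.
   In particular it kills ab when a and b come from the same vertex v but b
   does not follow a in the circular order of v, such as the square of a loop
   when v has valency at least two. *)
Inductive brauer_relation : kQ -> Prop :=
| BrauerRel1 a b of arrow_src a = arrow_src b :
    brauer_relation (special_power a - special_power b)
| BrauerRel2 a : brauer_relation (special_power a * arrow a)
| BrauerRel3 a b of arrow_tgt a = arrow_src b & b <> next_arrow a :
    brauer_relation (arrow a * arrow b).

Definition brauer_algebra : Type := quot_algebra brauer_relation.
HB.instance Definition _ := GRing.PzRing.on brauer_algebra.
HB.instance Definition _ := GRing.Lmodule.on brauer_algebra.

End BrauerAlgebra.

Definition in_center (R : pzRingType) (z : R) : Prop :=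
  forall x : R, GRing.comm z x.

(* The k-subspace of V described by P has a basis with d elements. *)
Definition has_dim (k : fieldType) (V : lmodType k) (P : V -> Prop) (d : nat)
    : Prop :=
  exists b : 'I_d -> V,
    [/\ forall i, P (b i),
        forall c : 'I_d -> k, \sum_i c i *: b i = 0 -> forall i, c i = 0
      & forall x, P x -> exists c : 'I_d -> k, x = \sum_i c i *: b i].

(* 'I_n.+1 carries addition modulo n.+1, so it is the alphabet Z_(n.+1) for
   every n.  Positions are counted from 0, and the last block of the text may
   be incomplete. *)
Definition vigenere_encrypt (n m : nat) (K : m.-tuple 'I_n.+1)
    (x : seq 'I_n.+1) : seq 'I_n.+1 :=
  [seq nth 0 x t + nth 0 K (t %% m) | t <- iota 0 (size x)].

Definition vigenere_list (n m : nat) (y : seq 'I_n.+1) (i : 'I_m)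
    : seq 'I_n.+1 :=
  [seq nth 0 y t | t <- iota 0 (size y) & (t %% m == i)%N].

Definition vigenere_config (n m : nat) (y : seq 'I_n.+1) : brauer_config :=
  @BrauerConfig 'I_n.+1 m (fun i => seq_mset (vigenere_list y i)) (fun=> 1%N).

(* Main.v *)
(* An element of the path algebra lies in the ideal of relations iff its
   coefficients vanish at the trivial paths and at the proper subpaths of the
   special cycles, and its coefficients at the special cycles based at any one
   polygon sum to zero.  These linear conditions are preserved by sandwiching a
   relation between two paths; conversely every path that does not run along a
   special cycle at most once is in the ideal.  Centrality modulo the ideal then
   becomes a condition on coefficients.  Commuting with the trivial paths and
   with the arrows leaves only multiples of 1 (the quiver is connected, as every
   vertex lies in every polygon), one special cycle for each polygon, and, for
   each loop x of the quiver, the special cycle of x with x removed.  Going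
   cyclically through the successor sequence of a vertex, the loops are the
   steps that stay in the same polygon, so polygon y_i contributes f_ij - 1. *)

Require Import Defs.
From HB Require Import structures.
From mathcomp Require Import all_boot all_algebra.
From mathcomp Require Import finmap multiset monalg.

Set Implicit Arguments.
Unset Strict Implicit.
Unset Printing Implicit Defensive.

Import GRing.Theory.
Local Open Scope ring_scope.

(* [ssrfun.pcomp] shadows the composition of paths. *)
Local Notation pcomp := Defs.pcomp.

(** * Coefficients of products with a path *)

Section PathCoefficients.
Variables (k : fieldType) (Q : quiver).
Local Notation kQ := (path_algebra k Q).
Implicit Types (f g : kQ) (p q w : qpath Q).

Definition pcoef w f : k := f@_w.

Lemma pcoefB w f g : pcoef w (f - g) = pcoef w f - pcoef w g.
Proof. exact: mcoeffB. Qed.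

HB.instance Definition _ w := GRing.isZmodMorphism.Build kQ k (pcoef w) (pcoefB w).

Lemma pcoefZ w c f : pcoef w (c *: f) = c * pcoef w f.
Proof. exact: mcoeffZ. Qed.

Lemma pcoef_path w p : pcoef w (pa_path k p) = (p == w)%:R.
Proof. by rewrite /pcoef pa_path.unlock mcoeffU. Qed.

Lemma pa_expand_pcoef f : f = \sum_(p <- msupp f) pcoef p f *: pa_path k p.
Proof. exact: pa_expand. Qed.

Lemma pa_mulpp p q : pa_path k p * pa_path k q = pa_opath k (pcomp p q).
Proof. exact: pa_mul_path. Qed.

Definition parrows p : seq (qarrow Q) := (val p).2.

Lemma pcompP p q r : pcomp p q = Some r ->
  [/\ ptgt p = psrc q, psrc r = psrc p & parrows r = parrows p ++ parrows q].
Proof.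
have [pq|npq] := eqVneq (ptgt p) (psrc q); last by rewrite pcompN.
have [s -> sE] := pcomp_spec pq.
by case=> <-; rewrite /psrc /parrows sE.
Qed.

Lemma qpath_inj p q : psrc p = psrc q -> parrows p = parrows q -> p = q.
Proof.
rewrite /psrc /parrows => h1 h2; apply: val_inj.
by case: (val p) (val q) h1 h2 => ? ? [? ?] /= -> ->.
Qed.

Lemma pcomp_injr p q q' r : pcomp p q = Some r -> pcomp p q' = Some r -> q = q'.
Proof.
move=> /pcompP[e _ s] /pcompP[e' _ s'].
apply: qpath_inj; first by rewrite -e -e'.
have /eqP : parrows p ++ parrows q = parrows p ++ parrows q' by rewrite -s -s'.
by rewrite eqseq_cat // => /andP[_ /eqP].
Qed.

Lemma parrows0 p : parrows p = [::] -> p = ptriv (psrc p).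
Proof. by move=> e; apply: qpath_inj. Qed.

Lemma ptgt_rcons p s a : parrows p = rcons s a -> ptgt p = qtgt a.
Proof. by rewrite /ptgt -/(parrows p) => ->; rewrite /walk_end map_rcons last_rcons. Qed.

Lemma psrc_cons p a s : parrows p = a :: s -> psrc p = qsrc a.
Proof.
rewrite /psrc /parrows; have := valP p; case: (val p) => v t /= w e.
by move: w; rewrite e /= => /andP[/eqP].
Qed.

Lemma pcomp_injl p p' q r : pcomp p q = Some r -> pcomp p' q = Some r -> p = p'.
Proof.
move=> /pcompP[_ e s] /pcompP[_ e' s'].
apply: qpath_inj; first by rewrite -e -e'.
have ss : size (parrows p) = size (parrows p').
  by apply: (@addIn (size (parrows q))); rewrite -!size_cat -s -s'.
have /eqP : parrows p ++ parrows q = parrows p' ++ parrows q by rewrite -s -s'.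
by rewrite eqseq_cat // => /andP[/eqP].
Qed.

Lemma pcoef_opath w o : pcoef w (pa_opath k o) = (o == Some w)%:R.
Proof. by case: o => [p|] /=; rewrite ?pcoef_path ?raddf0. Qed.

(** Meant for [F p] a product of [p] with a fixed path: by cancellation at most one [p] produces
    [w]. *)
Lemma pcoef_sum_only (F : qpath Q -> kQ) w q f :
    (forall p, pcoef w (F p) = (p == q)%:R) ->
  pcoef w (\sum_(p <- msupp f) pcoef p f *: F p) = pcoef q f.
Proof.
move=> hF; rewrite raddf_sum.
rewrite [in RHS](pa_expand_pcoef f) raddf_sum; apply: eq_bigr => p _.
by rewrite /= !pcoefZ hF pcoef_path.
Qed.

Lemma pa_pathM p f :
  pa_path k p * f = \sum_(q <- msupp f) pcoef q f *: pa_opath k (pcomp p q).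
Proof.
rewrite {1}(pa_expand_pcoef f) mulr_sumr; apply: eq_bigr => q _.
by rewrite -pa_scalerAr pa_mulpp.
Qed.

Lemma pa_mulpath p f :
  f * pa_path k p = \sum_(q <- msupp f) pcoef q f *: pa_opath k (pcomp q p).
Proof.
rewrite {1}(pa_expand_pcoef f) mulr_suml; apply: eq_bigr => q _.
by rewrite -pa_scalerAl pa_mulpp.
Qed.

Lemma pcoef_pathM p q w f : pcomp p q = Some w ->
  pcoef w (pa_path k p * f) = pcoef q f.
Proof.
move=> pq; rewrite pa_pathM; apply: pcoef_sum_only => q'.
rewrite pcoef_opath; congr ((nat_of_bool _)%:R); apply/idP/idP => [/eqP e|/eqP->].
  by rewrite (pcomp_injr e pq).
by rewrite pq.
Qed.

Lemma pcoef_Mpath p q w f : pcomp p q = Some w ->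
  pcoef w (f * pa_path k q) = pcoef p f.
Proof.
move=> pq; rewrite pa_mulpath; apply: pcoef_sum_only => p'.
rewrite pcoef_opath; congr ((nat_of_bool _)%:R); apply/idP/idP => [/eqP e|/eqP->].
  by rewrite (pcomp_injl e pq).
by rewrite pq.
Qed.

Lemma pcoef_pathM0 p w f : (forall q, pcomp p q <> Some w) ->
  pcoef w (pa_path k p * f) = 0.
Proof.
move=> h; rewrite pa_pathM raddf_sum big1 // => q _.
by rewrite /= pcoefZ pcoef_opath; case: eqP => [/h|]; rewrite ?mulr0.
Qed.

Lemma pcoef_Mpath0 q w f : (forall p, pcomp p q <> Some w) ->
  pcoef w (f * pa_path k q) = 0.
Proof.
move=> h; rewrite pa_mulpath raddf_sum big1 // => p _.
by rewrite /= pcoefZ pcoef_opath; case: eqP => [/h|]; rewrite ?mulr0.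
Qed.

Lemma pa_path_cat p s1 s2 : parrows p = s1 ++ s2 ->
  exists p1 p2, [/\ psrc p1 = psrc p, parrows p1 = s1, parrows p2 = s2
    & pa_path k p = pa_path k p1 * pa_path k p2].
Proof.
move=> e; have := valP p; rewrite /= -/(parrows p) e is_walk_cat.
case/andP=> w1 w2.
pose p1 := @QPath Q (psrc p, s1) w1; pose p2 := @QPath Q (walk_end (psrc p) s1, s2) w2.
exists p1, p2; split=> //.
rewrite pa_mulpp; have [|r -> rE] := @pcomp_spec Q p1 p2; first by [].
congr (pa_path k _); apply: qpath_inj; first by rewrite [in RHS]/psrc rE.
by rewrite [in RHS]/parrows rE.
Qed.

End PathCoefficients.

(** * Special cycles and the paths that run along them *)

Section BrauerIdeal.
Variables (k : fieldType) (C : brauer_config).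
Hypothesis mult1 : forall v : bc_vertex C, bc_mult v = 1%N.
Local Notation Q := (brauer_quiver C).
Local Notation kQ := (path_algebra k Q).
Local Notation arr := (bc_arrow C).
Local Notation nx := (@next_arrow C).
Local Notation path := (@pa_path k Q).
Local Notation rel := (@brauer_relation k C).
Implicit Types (a b : arr) (s t : seq arr) (f g h : kQ) (p q r : qpath Q).

Definition period a : nat := valency (tag a).

Lemma period_gt0 a : (0 < period a)%N.
Proof. by rewrite /period -size_succ_seq; case: (tagged a) => t /=; apply: leq_ltn_trans. Qed.

Lemma val_iter_ordS n (i : 'I_n) l : iter l (@ordS n) i = ((i + l) %% n)%N :> nat.
Proof.
elim: l => [|l IHl] /=; first by rewrite addn0 modn_small.
by rewrite IHl -addn1 modnDml addn1 addnS.
Qed.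

Lemma iter_next_arrow a l :
  iter l nx a = Tagged (fun v => 'I_(size (succ_seq v))) (iter l (@ordS _) (tagged a)).
Proof. by elim: l => [|l IHl]; [case: a | rewrite /= IHl]. Qed.

Lemma period_iter l a : period (iter l nx a) = period a.
Proof. by rewrite iter_next_arrow. Qed.

Lemma period_next a : period (nx a) = period a.
Proof. by []. Qed.

(** [nx] shifts the positions of one successor sequence cyclically, so its orbits have the valency
    as length. *)
Lemma iter_next_eq a l : (iter l nx a == a) = (period a %| l)%N.
Proof.
rewrite iter_next_arrow /period -size_succ_seq.
case: a => v i /=; rewrite -tag_eqE /tag_eq eqxx /= tagged_asE -val_eqE /=.
rewrite val_iter_ordS -[X in _ == X](modn_small (ltn_ord i)) -{2}[nat_of_ord i]addn0.
by rewrite eqn_modDl mod0n.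
Qed.

Lemma iter_period a : iter (period a) nx a = a.
Proof. by apply/eqP; rewrite iter_next_eq. Qed.

Lemma next_arrow_inj : injective nx.
Proof.
apply: (@can_inj _ _ _ (fun b => iter (period b).-1 nx b)) => a.
by rewrite period_next -iterSr prednK ?period_gt0 // iter_period.
Qed.

(* The arrow sequences of the paths with non-zero image in the quotient. *)
Definition runs s : bool :=
  if s is a :: s' then fpath nx a s' && (size s <= period a)%N else true.

Lemma runs_traject a l : (l <= period a)%N -> runs (traject nx a l).
Proof. by case: l => //= l; rewrite fpath_traject size_traject. Qed.

(** All arrows of a run lie on one special cycle and so share its period. *)
Lemma runs_period s a : runs s -> a \in s -> (size s <= period a)%N.
Proof.
case: s => //= b s /andP[/fpathP[l ->]].
by rewrite -trajectS => szb /trajectP[i _ ->]; rewrite period_iter.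
Qed.

Lemma runs_catr s t : runs (s ++ t) -> runs t.
Proof.
elim: s => // a s IHs /= h; apply: IHs.
by case: (s ++ t) h => //= b u /andP[/andP[/eqP<- ->]] /ltnW.
Qed.

Lemma is_walk_traject a l : is_walk (Q := Q) (arrow_src a) (traject nx a l).
Proof. by elim: l a => //= l IHl a; rewrite eqxx; apply: IHl. Qed.

Definition run a l : qpath Q := QPath (is_walk_traject a l : is_walk (_, _).1 (_, _).2).

Lemma psrc_run a l : psrc (run a l) = arrow_src a. Proof. by []. Qed.
Lemma parrows_run a l : parrows (run a l) = traject nx a l. Proof. by []. Qed.

Lemma ptgt_run a l : ptgt (run a l) = arrow_src (iter l nx a).
Proof.
case: l => // l; rewrite (@ptgt_rcons Q _ (traject nx a l) (iter l nx a)) //.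
by rewrite parrows_run trajectSr.
Qed.

Lemma run0 a : run a 0 = @ptriv Q (arrow_src a).
Proof. exact: qpath_inj. Qed.

Lemma run1 a : run a 1 = @parrow Q a.
Proof. exact: qpath_inj. Qed.

(** A trivial run remembers only its polygon, hence [0 < l]. *)
Lemma run_inj a l b l' : (0 < l)%N -> run a l = run b l' -> a = b /\ l = l'.
Proof.
move=> l_gt0 /(congr1 (@parrows Q)); rewrite !parrows_run => e.
have := congr1 size e; rewrite !size_traject => ll'.
by move: e; rewrite -ll'; case: l l_gt0 {ll'} => //= l _ [].
Qed.

Lemma run_neq_triv a l i : (0 < l)%N -> (run a l == @ptriv Q i) = false.
Proof. by case: l => // l _; apply/eqP => /(congr1 (@parrows Q)). Qed.

Lemma runsP p : runs (parrows p) ->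
  (p = ptriv (psrc p)) \/ (exists a l, (0 < l <= period a)%N /\ p = run a l).
Proof.
case E : (parrows p) => [|a s] /=; first by left; apply: parrows0.
case/andP=> /fpathP[l sE] sz; right; exists a, l.+1.
rewrite sE size_traject in sz; split; first by rewrite sz.
by apply: qpath_inj; rewrite ?psrc_run ?(psrc_cons E) // parrows_run E sE.
Qed.

Definition cyc a : qpath Q := run a (period a).

Lemma cyc_inj : injective cyc.
Proof. by move=> a b /run_inj[]//; apply: period_gt0. Qed.

Lemma ptgt_cyc a : ptgt (cyc a) = arrow_src a.
Proof. by rewrite ptgt_run iter_period. Qed.

(** A special cycle already has the maximal length of a run. *)
Lemma runs_cyc s t a : runs (s ++ parrows (cyc a) ++ t) -> s = [::] /\ t = [::].
Proof.
move=> h; have /(runs_period h) : a \in s ++ parrows (cyc a) ++ t.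
  rewrite !mem_cat parrows_run; case: (period a) (period_gt0 a) => //= l _.
  by rewrite inE eqxx orbT.
rewrite !size_cat parrows_run size_traject addnCA -[X in (_ <= X)%N]addn0 leq_add2l.
by rewrite leqn0 addn_eq0 !size_eq0 => /andP[/eqP-> /eqP->].
Qed.

Lemma pcomp_run a l l' : pcomp (run a l) (run (iter l nx a) l') = Some (run a (l + l')).
Proof.
have [|r -> rE] := @pcomp_spec _ (run a l) (run (iter l nx a) l'); first by rewrite ptgt_run.
congr Some; apply: val_inj; rewrite rE /=.
by rewrite trajectD.
Qed.

Lemma pa_path_run a l l' : path (run a (l + l')) = path (run a l) * path (run (iter l nx a) l').
Proof. by rewrite pa_mulpp pcomp_run. Qed.

Lemma special_powerE a : special_power k a = path (cyc a).
Proof.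
rewrite /special_power mult1 expr1 /special_cycle /cyc -/(period a).
case: (period a) (period_gt0 a) => // l _.
elim: l a => [|l IHl] a.
  by rewrite big_seq1 /arrow /pa_arrow -run1.
rewrite trajectS big_cons IHl -[l.+2]add1n pa_path_run /=.
by rewrite run1.
Qed.

(* The linear conditions that cut out the ideal of relations: all coefficients
   in a monomial basis of the quotient vanish, where the special cycles at a
   polygon have been identified. *)
Definition null f : Prop :=
  [/\ forall i, pcoef (@ptriv Q i) f = 0,
      forall a l, (0 < l < period a)%N -> pcoef (run a l) f = 0
    & forall i, \sum_(a | arrow_src a == i) pcoef (cyc a) f = 0].

(** * The linear conditions hold on the ideal of relations *)

Lemma null0 : null 0.
Proof. by split=> *; rewrite ?big1 // => *; rewrite raddf0. Qed.

Lemma nullB f g : null f -> null g -> null (f - g).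
Proof.
move=> [f1 f2 f3] [g1 g2 g3]; split=> [i|a l al|i].
- by rewrite raddfB /= f1 g1 subrr.
- by rewrite raddfB /= f2 // g2 // subrr.
by under eq_bigr do rewrite raddfB /=; rewrite sumrB f3 g3 subrr.
Qed.

Lemma nullD f g : null f -> null g -> null (f + g).
Proof. by move=> nf ng; rewrite -[g]opprK -[- g]sub0r; apply/nullB/nullB => //; apply: null0. Qed.

Lemma nullZ c f : null f -> null (c *: f).
Proof.
move=> [f1 f2 f3]; split=> [i|a l al|i]; rewrite ?pcoefZ ?f1 ?f2 ?mulr0 //.
by under eq_bigr do rewrite pcoefZ; rewrite -mulr_sumr f3 mulr0.
Qed.

Lemma null_sum (I : Type) (e : seq I) (F : I -> kQ) :
  (forall i, null (F i)) -> null (\sum_(i <- e) F i).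
Proof. by move=> hF; elim/big_ind: _ => // [|f g]; [apply: null0 | apply: nullD]. Qed.

(** The conditions of [null] only look at coefficients of paths that run. *)
Lemma null_path p : ~~ runs (parrows p) -> null (path p).
Proof.
have rp a l : (l <= period a)%N -> ~~ runs (parrows p) -> pcoef (run a l) (path p) = 0.
  move=> al dp; rewrite pcoef_path; case: eqP dp => // ->.
  by rewrite parrows_run runs_traject.
move=> dp; split=> [i|a l /andP[_ /ltnW/rp]|i]; last 2 first.
- exact.
- by apply: big1 => a _; apply: rp.
by rewrite pcoef_path; case: eqP dp => // ->.
Qed.

Lemma sum_pcoef_cyc a i :
  \sum_(b | arrow_src b == i) pcoef (cyc b) (path (cyc a)) = (arrow_src a == i)%:R.
Proof.
rewrite (eq_bigr (fun b => if b == a then 1 else 0)) => [|b _]; last first.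
  by rewrite pcoef_path (inj_eq cyc_inj) eq_sym; case: eqP.
rewrite -big_mkcondr /=; case: eqP => [sa|nsa].
  rewrite (big_pred1 a) // => b /=; case: (b =P a) => [->|_]; last by rewrite andbF.
  by rewrite sa !eqxx.
by rewrite big1 // => b /andP[/eqP bi /eqP e]; case: nsa; rewrite -e.
Qed.

Lemma null_cycB a b : arrow_src a = arrow_src b -> null (path (cyc a) - path (cyc b)).
Proof.
have run_cyc c d l : (l < period d)%N -> (cyc c == run d l) = false.
  move=> ld; apply/eqP=> /run_inj -/(_ (period_gt0 c))[cd].
  by move: ld => /[swap] <-; rewrite cd ltnn.
move=> ab; split=> [i|c l /andP[_ lc]|i].
- by rewrite raddfB /= !pcoef_path !run_neq_triv ?period_gt0 // subrr.
- by rewrite raddfB /= !pcoef_path !run_cyc // subrr.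
under eq_bigr do rewrite raddfB /=.
by rewrite sumrB !sum_pcoef_cyc ab subrr.
Qed.

Lemma null_mulpp p q : ~~ runs (parrows p ++ parrows q) -> null (path p * path q).
Proof.
move=> dpq; rewrite pa_mulpp; case E: (pcomp p q) => [r|] /=; last exact: null0.
by apply: null_path; have [_ _ ->] := pcompP E.
Qed.

Lemma null_mulppp p q r : ~~ runs (parrows p ++ parrows q ++ parrows r) ->
  null (path p * path q * path r).
Proof.
move=> d; rewrite pa_mulpp; case E: (pcomp p q) => [w|] /=; last first.
  by rewrite mul0r; apply: null0.
by apply: null_mulpp; have [_ _ ->] := pcompP E; rewrite -catA.
Qed.

Lemma null_sandwich f : (forall p q, null (path p * f * path q)) ->
  forall g h, null (g * f * h).
Proof.
move=> nf g h; rewrite (pa_expand_pcoef g) (pa_expand_pcoef h).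
rewrite mulr_sumr; apply: null_sum => q; rewrite !mulr_suml; apply: null_sum => p.
rewrite -pa_scalerAr; apply: nullZ; rewrite -!pa_scalerAl; apply: nullZ.
exact: nf.
Qed.

Lemma parrow_comp a b : arrow_tgt a = arrow_src b ->
  exists2 r : qpath Q, parrows r = [:: a; b] & arrow k a * arrow k b = path r.
Proof.
move=> ab; rewrite /arrow /pa_arrow pa_mulpp.
have [|r -> rE] := @pcomp_spec Q (@parrow Q a) (@parrow Q b); first exact: ab.
by exists r => //; rewrite /parrows rE.
Qed.

Lemma null_relation f : rel f -> forall g h, null (g * f * h).
Proof.
case=> [a b ab|a|a b ab nab]; apply: null_sandwich => p q.
- rewrite !special_powerE.
  (* With a non-trivial factor on either side neither cycle yields a run; trivial factors keep or
     kill both cycles together, as these share their polygon. *)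
  have [pq|npq] := boolP ((parrows p == [::]) && (parrows q == [::])); last first.
    rewrite mulrBr mulrBl; apply: nullB; apply: null_mulppp;
      by apply: contra npq => /runs_cyc[-> ->]; rewrite !eqxx.
  case/andP: pq => /eqP/parrows0-> /eqP/parrows0->.
  move: (psrc p) (psrc q) => i j.
  rewrite mulrBr mulrBl !pa_mulpp !pcomp1p !psrc_run -ab.
  case: ifP => _ /=; last by rewrite !mul0r subrr; apply: null0.
  rewrite !pa_mulpp !pcompp1 !ptgt_cyc -ab.
  by case: ifP => _ /=; [apply: null_cycB | rewrite subrr; apply: null0].
- rewrite special_powerE /arrow /pa_arrow !mulrA -mulrA [path (parrow _) * _]pa_mulpp.
  case E: (pcomp _ q) => [w|] /=; last by rewrite mulr0; apply: null0.
  apply: null_mulppp; have [_ _ ->] := pcompP E.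
  by apply/negP => /runs_cyc[_].
have [w wE ->] := parrow_comp ab; apply: null_mulppp; rewrite wE.
apply/negP => /runs_catr/=; case/andP=> /andP[/eqP e _] _.
by apply: nab.
Qed.

Lemma ideal_null f : ideal_gen rel f -> null f.
Proof.
(* The elements whose sandwiches are all null form an ideal containing the relations; sandwiching by
   1 returns to [null]. *)
suff J : two_sided_ideal (fun f => forall g h, null (g * f * h)).
  by move=> /(_ _ J null_relation)/(_ 1 1); rewrite mul1r mulr1.
split=> [g h|x y nx ny g h|a x nx].
- by rewrite mulr0 mul0r; apply: null0.
- by rewrite mulrBr mulrBl; apply: nullB.
by split=> g h; [rewrite mulrA | rewrite mulrA -mulrA]; apply: nx.
Qed.

(** * Conversely, the linear conditions imply membership in the ideal *)

Lemma idealB f g : ideal_gen rel f -> ideal_gen rel g -> ideal_gen rel (f - g).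
Proof. by have [_ + _] := ideal_gen_ideal rel; apply. Qed.

Lemma idealMl f g : ideal_gen rel g -> ideal_gen rel (f * g).
Proof. by have [_ _ h] := ideal_gen_ideal rel => /(h f)[]. Qed.

Lemma idealMr f g : ideal_gen rel f -> ideal_gen rel (f * g).
Proof. by have [_ _ h] := ideal_gen_ideal rel => /(h g)[]. Qed.

Lemma ideal_relation f : rel f -> ideal_gen rel f.
Proof. by move=> rf J _; apply. Qed.

(** Such a path has a factor from the third relation, if two consecutive arrows break the cyclic
    order, or from the second, if it is longer than one turn. *)
Lemma ideal_path p : ~~ runs (parrows p) -> ideal_gen rel (path p).
Proof.
case E: (parrows p) => [|a s] //=; have [fp|nfp _] := boolP (fpath nx a s).
  rewrite /= -ltnNge => sz.
  (* One full turn comes back to [a], so the path starts with a special cycle followed by its first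
     arrow. *)
  have [l sE] : exists l, a :: s = traject nx a (period a) ++ a :: traject nx (nx a) l.
    have sl : (size s).+1 = (period a + (size s - period a).+1)%N by rewrite addnS subnKC.
    exists (size s - period a)%N.
    by rewrite {1}(fpathE fp) -!trajectS sl trajectD iter_period.
  rewrite sE -cat_rcons in E.
  have [p1 [p2 [s1 E1 _ ->]]] := pa_path_cat k E; apply: idealMr.
  have E1' : parrows p1 = traject nx a (period a) ++ [:: a] by rewrite cats1.
  have [q1 [q2 [t1 F1 F2 ->]]] := pa_path_cat k E1'.
  have -> : q1 = cyc a.
    apply: qpath_inj; rewrite // psrc_run.
    apply: (@psrc_cons Q _ a (traject nx (nx a) (period a).-1)).
    by rewrite F1 -trajectS prednK ?period_gt0.
  have -> : q2 = @parrow Q a by apply: qpath_inj; rewrite // (psrc_cons F2).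
  by rewrite -special_powerE; apply: ideal_relation; apply: BrauerRel2.
(* The arrows before the first break of the cyclic order are peeled off as left factors. *)
elim: s a p E nfp => // b s IHs a p E; rewrite [fpath _ _ _]/= negb_and.
have [_|nab _] := eqVneq (nx a) b.
  move=> /= h.
  have E' : parrows p = [:: a] ++ b :: s by [].
  have [p1 [p2 [_ _ E2 ->]]] := pa_path_cat k E'.
  by apply: idealMl; apply: IHs E2 h.
have E' : parrows p = [:: a; b] ++ s by [].
have [p1 [p2 [_ E1 _ ->]]] := pa_path_cat k E'; apply: idealMr.
have ab : arrow_tgt a = arrow_src b.
  have := valP p1; rewrite -/(psrc p1) -/(parrows p1) E1 /=.
  by case/andP=> _ /andP[/eqP <-].
have [w wE e] := parrow_comp ab.
have -> : p1 = w.
  by apply: qpath_inj; rewrite ?wE // (psrc_cons E1) (psrc_cons wE).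
by rewrite -e; apply: ideal_relation; apply: BrauerRel3 => // h; rewrite h eqxx in nab.
Qed.

Lemma ideal_sum (I : Type) (e : seq I) (P : pred I) (F : I -> kQ) :
  (forall i, P i -> ideal_gen rel (F i)) -> ideal_gen rel (\sum_(i <- e | P i) F i).
Proof.
have [h0 _ _] := ideal_gen_ideal rel.
move=> hF; elim/big_ind: _ => // f g hf hg.
by rewrite -[g]opprK; apply: idealB => //; rewrite -sub0r; apply: idealB.
Qed.

Lemma null_ideal f : null f -> ideal_gen rel f.
Proof.
move=> [f1 f2 f3].
(* [g] is the part of [f] on special cycles; the rest is supported on paths that do not run. *)
pose g := \sum_a pcoef (cyc a) f *: path (cyc a).
suff [hg hfg] : ideal_gen rel g /\ ideal_gen rel (f - g).
  have [h0 _ _] := ideal_gen_ideal rel.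
  rewrite -(subrK g f) -[X in _ + X]opprK; apply: idealB => //.
  by rewrite -sub0r; apply: idealB.
split.
  rewrite /g (partition_big (@arrow_src C) xpredT) //=; apply: ideal_sum => i _.
  case: (pickP (fun a => arrow_src a == i)) => [b /eqP bi|none]; last first.
    by rewrite big_pred0 //; have [] := ideal_gen_ideal rel.
  (* The coefficients at polygon [i] sum to zero, so one fixed cycle may be subtracted from each,
     which leaves relations of the first kind. *)
  suff -> : \sum_(a | arrow_src a == i) pcoef (cyc a) f *: path (cyc a) =
      \sum_(a | arrow_src a == i) pcoef (cyc a) f *: (path (cyc a) - path (cyc b)).
    apply: ideal_sum => a /eqP ai; apply: ideal_gen_scale.
    by rewrite -!special_powerE; apply: ideal_relation; apply: BrauerRel1; rewrite ai.
  have e : \sum_(a | arrow_src a == i) pcoef (cyc a) f *: path (cyc b) = 0.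
    by rewrite -scaler_suml f3 scale0r.
  rewrite -[LHS]subr0 -[X in _ - X]e -sumrB; apply: eq_bigr => a _.
  by rewrite scalerBr.
have cg w : pcoef w g = \sum_a pcoef (cyc a) f * (cyc a == w)%:R.
  by rewrite raddf_sum; apply: eq_bigr => a _; rewrite /= pcoefZ pcoef_path.
have cg0 w : (forall a, cyc a <> w) -> pcoef w g = 0.
  by move=> h; rewrite cg big1 // => a _; case: eqP => [/h|] //; rewrite mulr0.
rewrite (pa_expand_pcoef (f - g)); apply: ideal_sum => p _.
have [rp|/ideal_path] := boolP (runs (parrows p)); last exact: ideal_gen_scale.
suff -> : pcoef p (f - g) = 0 by rewrite scale0r; have [] := ideal_gen_ideal rel.
rewrite raddfB /=; case: (runsP rp) => [-> | [a [l [/andP[l0 la] ->]]]].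
  rewrite f1 cg0 ?subrr // => a /eqP; rewrite run_neq_triv //.
  exact: period_gt0.
move: la; rewrite leq_eqVlt => /predU1P[->|la].
  rewrite cg (bigD1 a) //= eqxx mulr1 big1 ?addr0 ?subrr // => b ba.
  by rewrite (inj_eq cyc_inj) (negbTE ba) mulr0.
rewrite f2 ?l0 // cg0 ?subrr // => b /run_inj -/(_ (period_gt0 b))[ba bl].
by rewrite -bl ba ltnn in la.
Qed.

End BrauerIdeal.

(** * Dimension from a basis indexed by a finite type *)

Lemma has_dim_finType (k : fieldType) (V : lmodType k) (P : V -> Prop)
    (I : finType) (b : I -> V) :
  (forall i, P (b i)) ->
  (forall c : I -> k, \sum_i c i *: b i = 0 -> forall i, c i = 0) ->
  (forall x, P x -> exists c : I -> k, x = \sum_i c i *: b i) ->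
  has_dim P #|I|.
Proof.
have reidx (F : I -> V) : \sum_i F i = \sum_(j < #|I|) F (enum_val j).
  by rewrite (reindex (@enum_val I I)) //=; apply: onW_bij; apply: enum_val_bij.
move=> Pb free_b span_b; exists (b \o enum_val); split=> [i|c c0 i|x /span_b[c ->]].
- exact: Pb.
- rewrite -(enum_valK i); apply: (free_b (c \o enum_rank)).
  rewrite reidx -[RHS]c0; apply: eq_bigr => j _.
  by rewrite /= enum_valK.
by exists (c \o enum_val); rewrite reidx.
Qed.

(** * The center when every polygon contains every vertex *)

Section BrauerCenter.
Variables (k : fieldType) (C : brauer_config).
Hypothesis mult1 : forall v : bc_vertex C, bc_mult v = 1%N.
Hypothesis all_in : forall i v, (0 < @bc_polygon C i v)%N.
Hypothesis npoly_gt1 : (1 < bc_npoly C)%N.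
Variable v0 : bc_vertex C.
Local Notation Q := (brauer_quiver C).
Local Notation kQ := (path_algebra k Q).
Local Notation arr := (bc_arrow C).
Local Notation nx := (@next_arrow C).
Local Notation path := (@pa_path k Q).
Local Notation rel := (@brauer_relation k C).
Local Notation ideal_null := (@ideal_null k C mult1).
Local Notation null_ideal := (@null_ideal k C mult1).
Implicit Types (a b : arr) (s t : seq arr) (f g h : kQ) (p q r : qpath Q).

Lemma mem_succ_seq i v : i \in @succ_seq C v.
Proof.
apply/flattenP; exists (nseq (bc_polygon i v) i); last by rewrite mem_nseq eqxx all_in.
by apply/mapP; exists i; rewrite ?mem_enum.
Qed.

Lemma arrow_src_surj v i : exists2 a : arr, tag a = v & arrow_src a = i.
Proof.
have /(tnthP (in_tuple (succ_seq v)))[j ij] := mem_succ_seq i v.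
by exists (Tagged (fun v => 'I_(size (@succ_seq C v))) j).
Qed.

(** Each of the at least two polygons adds to the valency. Hence a single arrow is a proper subpath
    of its special cycle. *)
Lemma period_gt1 a : (1 < period a)%N.
Proof.
apply: leq_trans npoly_gt1 _; rewrite /period /valency -{1}[bc_npoly C]card_ord -sum1_card.
by apply: leq_sum => i _; apply: all_in.
Qed.

Lemma iter_next_tag a b : tag a = tag b -> exists l, b = iter l nx a.
Proof.
case: a b => v i [w j] /= vw; subst w.
(* From position [i] round to the start of the successor sequence, then on to [j]. *)
exists (size (succ_seq v) - i + j)%N; rewrite iter_next_arrow; congr Tagged.
apply: val_inj; rewrite -[RHS]/(nat_of_ord _) val_iter_ordS addnA subnKC ?modnDl ?modn_small //.
exact/ltnW.
Qed.

Definition loop a := arrow_src a == arrow_tgt a.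

(* A loop [x] of period n commutes past the rest of its special cycle: both
   products are special cycles at the polygon of [x]. *)
Definition loop_path x : qpath Q := run (nx x) (period x).-1.

(** Centrality modulo the ideal, stated on representatives in the path algebra. *)
Definition central f := forall g, null (f * g - g * f).

Lemma centralP f : (forall p, null (f * path p - path p * f)) -> central f.
Proof.
move=> cf g; rewrite (pa_expand_pcoef g) mulr_sumr mulr_suml -sumrB.
apply: null_sum => p.
by rewrite -pa_scalerAr -pa_scalerAl -scalerBr; apply: nullZ.
Qed.

Lemma closed_triv_comm p i : psrc p = ptgt p ->
  path p * path (ptriv i) = path (ptriv i) * path p.
Proof. by move=> pp; rewrite !pa_mulpp pcomp1p pcompp1 pp. Qed.

Lemma central1 : central 1.
Proof. by move=> g; rewrite mul1r mulr1 subrr; apply: null0. Qed.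

(** Trivial paths commute with a closed path, and any other path multiplies a special cycle into the
    ideal. *)
Lemma central_cyc a : central (path (cyc a)).
Proof.
apply: centralP => p; have [/eqP/parrows0->|np] := boolP (parrows p == [::]).
  by rewrite closed_triv_comm ?subrr ?ptgt_cyc //; apply: null0.
apply: nullB; apply: null_mulpp; apply: contra np.
  by move=> h; have [_ ->] := @runs_cyc C [::] _ a h.
by move=> h; have [|-> _] := @runs_cyc C (parrows p) [::] a; rewrite ?cats0.
Qed.

Lemma runs_traject_rcons a l b : (0 < l)%N -> runs (rcons (traject nx a l) b) -> b = iter l nx a.
Proof.
case: l => // l _ /= /andP[+ _]; rewrite rcons_path => /andP[_ /eqP<-].
by rewrite last_traject.
Qed.

Lemma central_loop_path x : loop x -> central (path (loop_path x)).
Proof.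
move=> /eqP lx; have x1 := period_gt1 x.
have x0 : (0 < (period x).-1)%N by rewrite -ltnS prednK ?period_gt0.
have xK : iter (period x).-1 nx (nx x) = x by rewrite -iterSr prednK ?period_gt0 // iter_period.
have mem_nx : nx x \in parrows (loop_path x).
  by rewrite parrows_run; case: (_.-1) x0 => //= l _; rewrite inE eqxx.
have sz : size (parrows (loop_path x)) = (period x).-1 by rewrite size_traject.
apply: centralP => p; case E: (parrows p) => [|b s].
  rewrite (parrows0 E) closed_triv_comm ?subrr; first exact: null0.
  by rewrite ptgt_run xK psrc_run lx.
(* The arrow [x] itself gives special cycles on both sides, at a common polygon because [x] is a
   loop. *)
have [px|npx] := eqVneq p (run x 1).
  have -> : path (loop_path x) * path p = path (cyc (nx x)).
    rewrite px -{2}xK -pa_path_run addn1 prednK ?period_gt0 //.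
  have -> : path p * path (loop_path x) = path (cyc x).
    by rewrite px -pa_path_run add1n prednK ?period_gt0.
  by apply: null_cycB; rewrite [RHS]lx.
have bsx : b = x -> s = [::] -> False.
  move=> bx s0; case/eqP: npx; apply: qpath_inj; last by rewrite E bx s0.
  by rewrite (psrc_cons E) bx.
have s0 : (size s + period x <= period x)%N -> s = [::].
  by rewrite -{2}[period x]add0n leq_add2r leqn0 => /eqP/size0nil.
(* Any other product that ran would fill the period, so [p] would be one arrow, necessarily [x]. *)
apply: nullB; apply: null_mulpp; apply/negP; rewrite E => h.
  have sE : s = [::].
    have := runs_period h _; move/(_ (nx x)); rewrite mem_cat mem_nx => /(_ isT).
    by rewrite size_cat sz period_next /= addnS -addSn prednK ?period_gt0 // addnC => /s0.
  by move: h; rewrite sE cats1 => /(runs_traject_rcons x0); rewrite xK => /bsx; apply.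
have sE : s = [::].
  have := runs_period h _; move/(_ (nx x)); rewrite mem_cat mem_nx orbT => /(_ isT).
  by rewrite size_cat sz period_next /= addSn -addnS prednK ?period_gt0 // => /s0.
apply: (bsx _ sE); apply: next_arrow_inj.
move: h; rewrite sE parrows_run; case: (_.-1) x0 => //= l _.
by case/andP=> /andP[/eqP].
Qed.

(** * Constraints on the coefficients of a central element *)

Section CentralCoefficients.
Variable f : kQ.
Hypothesis cf : central f.

Lemma central_pcoef_run a l g : (0 < l < period a)%N ->
  pcoef (run a l) (f * g) = pcoef (run a l) (g * f).
Proof.
by move=> al; apply/eqP; rewrite -subr_eq0 -raddfB /=; have [_ -> //] := cf g.
Qed.

(** Multiplying [f] on the right by the trivial path at the end of the run keeps the coefficient; on
    the left it gives zero, since the run starts elsewhere. *)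
Lemma central_run_open a l : (0 < l < period a)%N ->
  arrow_src a != arrow_src (iter l nx a) -> pcoef (run a l) f = 0.
Proof.
move=> al nal; have e := pcompp1 (ptgt (run a l)) (run a l); rewrite eqxx in e.
rewrite -(pcoef_Mpath f e) central_pcoef_run //; apply: pcoef_pathM0 => q /pcompP[_ + _].
by move/eqP; rewrite psrc_run ptgt_run (negbTE nal).
Qed.

(** [run x l.+1] begins with [x] but does not end with it: its coefficient is the one sought after
    multiplying by [x] on the left, and zero on the right. The bound keeps this longer run
    proper. *)
Lemma central_run_short x l : (0 < l)%N -> (l.+1 < period x)%N ->
  pcoef (run (nx x) l) f = 0.
Proof.
move=> l0 xl; rewrite -(pcoef_pathM f (pcomp_run x 1 l)) add1n -central_pcoef_run //.
apply: pcoef_Mpath0 => p /pcompP[_ _] /eqP.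
rewrite !parrows_run trajectSr cats1 eqseq_rcons => /andP[_].
by rewrite iter_next_eq => /dvdn_leq-/(_ l0); rewrite leqNgt ltnW.
Qed.

(** The coefficients of the arrow [a] in its products with [f] are those of [f] at the source and
    the target of [a]. *)
Lemma central_triv_next a :
  pcoef (@ptriv Q (arrow_src (nx a))) f = pcoef (@ptriv Q (arrow_src a)) f.
Proof.
rewrite -!run0 -(pcoef_Mpath f (pcomp_run a 0 1)) -(pcoef_pathM f (pcomp_run a 1 0)).
by rewrite central_pcoef_run ?period_gt1.
Qed.

(** The special cycle of [v0] passes through every polygon. *)
Lemma central_triv (i j : qvert Q) : pcoef (ptriv i) f = pcoef (ptriv j) f.
Proof.
have [a av <-] := arrow_src_surj v0 i; have [b bv <-] := arrow_src_surj v0 j.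
have [|l ->] := @iter_next_tag a b; first by rewrite av.
by elim: l => //= l ->; rewrite central_triv_next.
Qed.

Lemma central_run a l : (0 < l < period a)%N ->
  (forall x, loop x -> run a l <> loop_path x) -> pcoef (run a l) f = 0.
Proof.
case/andP=> l0 la nloop; have [x ax] : exists x, a = nx x.
  by exists (iter (period a).-1 nx a); rewrite -iterS prednK ?period_gt0 // iter_period.
move: la nloop; rewrite {a}ax period_next => lx nloop.
have [lx1|] := ltnP l.+1 (period x); first exact: central_run_short.
move=> lx1; have lE : l = (period x).-1.
  by apply/eqP; rewrite -eqSS prednK ?period_gt0 // eqn_leq lx.
(* The remaining run is a special cycle without its last arrow [x], and is closed only if [x] is a
   loop. *)
apply: central_run_open; first by rewrite l0.
rewrite lE -iterSr prednK ?period_gt0 // iter_period eq_sym.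
by apply/negP => /nloop; rewrite /loop_path -lE.
Qed.

End CentralCoefficients.

(** * Independence and spanning of the candidate basis *)

Lemma pcoef1_triv i : pcoef (ptriv i) (1 : kQ) = 1.
Proof.
have -> : (1 : kQ) = \sum_v path (ptriv v) by [].
rewrite raddf_sum (bigD1 i) //= pcoef_path eqxx big1 ?addr0 // => j ji.
by rewrite pcoef_path; case: (@ptriv Q j =P ptriv i) ji => // -[->]; rewrite eqxx.
Qed.

Lemma pcoef1_run a l : (0 < l)%N -> pcoef (run a l) (1 : kQ) = 0.
Proof.
have -> : (1 : kQ) = \sum_v path (ptriv v) by [].
move=> l0; rewrite raddf_sum big1 // => i _.
by rewrite /= pcoef_path eq_sym run_neq_triv.
Qed.

Lemma loop_path_inj : injective loop_path.
Proof.
move=> x y /run_inj[]; last by move/next_arrow_inj.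
by rewrite -ltnS prednK ?period_gt0 // period_gt1.
Qed.

Lemma loop_path_neq_cyc x a : (loop_path x == cyc a) = false.
Proof.
apply/eqP => /esym/run_inj-/(_ (period_gt0 a))[ax e].
by move: (period_gt0 x); rewrite -ltn_predL -e ax period_next ltnn.
Qed.

Section Combinations.
Variable at_poly : 'I_(bc_npoly C) -> arr.
Hypothesis at_polyE : forall i, arrow_src (at_poly i) = i.
Variables (c0 : k) (c1 : 'I_(bc_npoly C) -> k) (c2 : {x | loop x} -> k).

(** One special cycle per polygon is chosen by [at_poly], as all those at a polygon agree in the
    quotient. *)
Definition comb : kQ := c0 *: (1 : kQ) + (\sum_i c1 i *: path (cyc (at_poly i))
  + \sum_x c2 x *: path (loop_path (val x))).

Lemma pcoef_comb w : pcoef w comb = c0 * pcoef w 1 +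
  (\sum_i c1 i * (cyc (at_poly i) == w)%:R + \sum_x c2 x * (loop_path (val x) == w)%:R).
Proof.
rewrite /comb !raddfD /= pcoefZ; congr (_ + (_ + _)); rewrite raddf_sum.
  by apply: eq_bigr => i _; rewrite /= pcoefZ pcoef_path.
by apply: eq_bigr => i _; rewrite /= pcoefZ pcoef_path.
Qed.

Lemma pcoef_comb_triv i : pcoef (@ptriv Q i) comb = c0.
Proof.
rewrite pcoef_comb pcoef1_triv mulr1 !big1 ?addr0 // => x _.
  rewrite run_neq_triv ?mulr0 // -ltnS prednK ?period_gt0 //.
  exact: period_gt1.
by rewrite run_neq_triv ?mulr0 ?period_gt0.
Qed.

Lemma pcoef_comb_run a l : (0 < l < period a)%N ->
  pcoef (run a l) comb = \sum_x c2 x * (loop_path (val x) == run a l)%:R.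
Proof.
case/andP=> l0 la; rewrite pcoef_comb pcoef1_run // mulr0 add0r big1 ?add0r // => i _.
case: eqP => [/run_inj|]; last by rewrite mulr0.
by move/(_ (period_gt0 _)) => [ea el]; rewrite -el ea ltnn in la.
Qed.

Lemma loop_path_len x : (0 < (period x).-1 < period (nx x))%N.
Proof. by rewrite period_next ltn_predL period_gt0 -ltnS prednK ?period_gt0 // period_gt1. Qed.

Lemma pcoef_comb_loop (x : {x | loop x}) : pcoef (loop_path (val x)) comb = c2 x.
Proof.
rewrite pcoef_comb_run ?loop_path_len // (bigD1 x) //= eqxx mulr1 big1 ?addr0 // => y yx.
by rewrite -/(loop_path _) (inj_eq loop_path_inj) (inj_eq val_inj) (negbTE yx) mulr0.
Qed.

(** Summing over all special cycles at [i] counts the chosen one once and those chosen at other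
    polygons never. *)
Lemma pcoef_comb_cyc i : \sum_(a | arrow_src a == i) pcoef (cyc a) comb = c1 i.
Proof.
transitivity (\sum_(a | arrow_src a == i) \sum_j c1 j * (cyc (at_poly j) == cyc a)%:R).
  apply: eq_bigr => a _; rewrite pcoef_comb pcoef1_run ?period_gt0 // mulr0 add0r.
  rewrite [X in _ + X]big1 ?addr0 // => x _.
  by rewrite loop_path_neq_cyc mulr0.
have sumE j : \sum_(a | arrow_src a == i) c1 j * (cyc (at_poly j) == cyc a)%:R
    = c1 j * (j == i)%:R.
  rewrite -mulr_sumr -[in X in _ = _ * X](at_polyE j) -(sum_pcoef_cyc k).
  congr (_ * _).
  by apply: eq_bigr => a _; rewrite pcoef_path.
rewrite exchange_big; under eq_bigr do rewrite sumE.
rewrite (bigD1 i) //= eqxx mulr1 big1 ?addr0 // => j /negbTE ->.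
by rewrite mulr0.
Qed.

Lemma null_comb : null comb -> [/\ c0 = 0, forall i, c1 i = 0 & forall x, c2 x = 0].
Proof.
case=> h0 h2 h1; split=> [|i|x].
- by rewrite -(pcoef_comb_triv (arrow_src (at_poly (Ordinal (ltnW npoly_gt1))))) h0.
- by rewrite -pcoef_comb_cyc h1.
by rewrite -pcoef_comb_loop h2 // loop_path_len.
Qed.

End Combinations.

(** The coordinates are values of the functionals that define [null]; centrality makes [f] vanish at
    all other proper subpaths. *)
Lemma central_null_comb at_poly f (atE : forall i, arrow_src (at_poly i) = i) i0 :
    central f ->
  null (f - comb at_poly (pcoef (@ptriv Q i0) f)
    (fun i => \sum_(a | arrow_src a == i) pcoef (cyc a) f)
    (fun x => pcoef (loop_path (val x)) f)).
Proof.
move=> cf; split=> [i|a l al|i].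
- by rewrite raddfB /= pcoef_comb_triv (central_triv cf i i0) subrr.
- rewrite raddfB /= pcoef_comb_run //.
  case: (pickP (fun x : {x | loop x} => loop_path (val x) == run a l)) => [x /eqP xE|none].
    rewrite (bigD1 x) //= xE eqxx mulr1 big1 ?addr0 ?subrr // => y yx.
    by rewrite -xE (inj_eq loop_path_inj) (inj_eq val_inj) (negbTE yx) mulr0.
  rewrite central_run // => [|x lx e]; last by have := none (exist _ x lx); rewrite /= e eqxx.
  by rewrite big1 ?subrr // => x _; rewrite none mulr0.
by under eq_bigr do rewrite raddfB /=; rewrite sumrB pcoef_comb_cyc // subrr.
Qed.

(** * Passage to the quotient algebra *)

Local Notation Lambda := (brauer_algebra k C).
Local Notation pi := (quot_pi rel : kQ -> Lambda).

Lemma pi_null f g : pi f = pi g <-> null (f - g).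
Proof.
by split=> [/quot_piP/ideal_null|/null_ideal/quot_piP].
Qed.

Lemma pi_centralP f : in_center (pi f) <-> central f.
Proof.
split=> [h g|h]; last elim/quot_ind=> g.
  by apply/pi_null; rewrite !quot_piM; apply: h.
by have /pi_null := h g; rewrite !quot_piM.
Qed.

Lemma pi0 : pi 0 = 0.
Proof. by apply: (addrI (pi 0)); rewrite -quot_piD !addr0. Qed.

Lemma pi_sum (I : finType) (c : I -> k) (F : I -> kQ) :
  pi (\sum_i c i *: F i) = \sum_i c i *: pi (F i).
Proof.
rewrite (big_morph pi (@quot_piD _ rel) pi0); apply: eq_bigr => i _.
exact: quot_piZ.
Qed.

Theorem has_dim_center :
  has_dim (V := Lambda) (@in_center Lambda) (1 + (bc_npoly C + #|loop|)).
Proof.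
have src_surj (i : 'I_(bc_npoly C)) : exists a, arrow_src a == i.
  by have [a _ <-] := arrow_src_surj v0 i; exists a.
pose at_poly i := xchoose (src_surj i).
have atE i : arrow_src (at_poly i) = i by apply/eqP: (xchooseP (src_surj i)).
pose I : finType := ('I_1 + ('I_(bc_npoly C) + {x | loop x}))%type.
have -> : (1 + (bc_npoly C + #|loop|))%N = #|I| by rewrite !card_sum !card_ord card_sig.
pose beta (u : I) : kQ := match u with
  | inl _ => 1
  | inr (inl i) => path (cyc (at_poly i))
  | inr (inr x) => path (loop_path (val x)) end.
have combE (c : I -> k) : \sum_u c u *: beta u =
    comb at_poly (c (inl ord0)) (c \o inr \o inl) (c \o inr \o inr).
  by rewrite !big_sumType /= big_ord1.
apply: (@has_dim_finType k Lambda _ I (pi \o beta)) => [u|c|].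
- apply/pi_centralP; case: u => [i|[i|x]] /=.
  + exact: central1.
  + exact: central_cyc.
  + by apply: central_loop_path; apply: valP.
- rewrite -pi_sum combE -pi0 => /pi_null; rewrite subr0 => /(null_comb atE)[h0 h1 h2].
  by case=> [i|[i|x]]; rewrite ?[i]ord1; [exact: h0 | exact: h1 | exact: h2].
elim/quot_ind=> f /pi_centralP cf.
have nf := central_null_comb atE (Ordinal (ltnW npoly_gt1)) cf.
exists (fun u : I => match u with
  | inl _ => pcoef (@ptriv Q (Ordinal (ltnW npoly_gt1))) f
  | inr (inl i) => \sum_(a | arrow_src a == i) pcoef (cyc a) f
  | inr (inr x) => pcoef (loop_path (val x)) f end).
by rewrite -pi_sum combE; apply/pi_null.
Qed.

End BrauerCenter.

(** * Counting the loops in the successor sequences *)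

Lemma card_cyclic_repeat (T : eqType) (x : T) (s : seq T) :
  #|[pred t | tnth (in_tuple s) t == tnth (in_tuple s) (ordS t)]|
    = count id (pairmap eq_op (last x s) s).
Proof.
case: s => [|y s]; first by rewrite eq_card0 // => -[].
(* The last index is split off: its cyclic successor is the first term, and this is the comparison
   that [pairmap] makes first. *)
rewrite -sum1_card big_mkcond /= big_ord_recr addnC /=; congr (_ + _)%N; last first.
  rewrite inE !(tnth_nth y) /= modnn -[X in nth _ _ X]/(size (y :: s)).-1 nth_last /=.
  by case: eqP.
transitivity (\sum_(i < size s) (nth false (pairmap eq_op y s) i : nat))%N.
  apply: eq_bigr => i _; rewrite inE !(tnth_nth y) /= modn_small ?ltnS //.
  by rewrite (nth_pairmap y) //=; case: eqP.
elim: s y => [|z s IHs] y /=; first by rewrite big_ord0.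
by rewrite big_ord_recl /= -IHs.
Qed.

(** Ensures that the closing step of a successor sequence, from the last polygon to the first, is
    not a loop. *)
Lemma path_last_neq (T : eqType) (x : T) (s : seq T) :
  uniq s -> (1 < size s)%N -> path (fun i j => i != j) (last x s) s.
Proof.
case: s => [|i [|j s]] // us _; apply/andP; split.
  by move: us; rewrite /= => /and3P[+ _ _]; apply: contraNneq => <-; apply: mem_last.
by apply: (pairwise_sorted (s := i :: j :: s)); rewrite -uniq_pairwise.
Qed.

Section FlattenRuns.
Variables (T : eqType) (F : T -> nat).
Hypothesis F_gt0 : forall i, (0 < F i)%N.
Local Notation blocks l := (flatten [seq nseq (F i) i | i <- l]).

Lemma last_blocks x l : last x (blocks l) = last x l.
Proof.
elim: l x => //= i l IHl x; rewrite last_cat -IHl.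
by case: (F i) (F_gt0 i) => //= n _; congr last; elim: n.
Qed.

(** A block of [F i] copies has [F i - 1] equal neighbours inside, and adjacent blocks carry
    different values. *)
Lemma count_repeat_blocks x l : path (fun i j => i != j) x l ->
  count id (pairmap eq_op x (blocks l)) = (\sum_(i <- l) (F i).-1)%N.
Proof.
elim: l x => [|i l IHl] x /=; first by rewrite big_nil.
case/andP=> xi /IHl; rewrite big_cons pairmap_cat count_cat => <-.
case: (F i) (F_gt0 i) => //= n _; rewrite (negbTE xi) add0n.
have -> : last i (nseq n i) = i by elim: n.
by congr (_ + _)%N; elim: n => //= n ->; rewrite eqxx.
Qed.

End FlattenRuns.

Lemma card_loop (C : brauer_config) :
  (forall i v, (0 < @bc_polygon C i v)%N) -> (1 < bc_npoly C)%N ->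
  #|@loop C| = (\sum_(i < bc_npoly C) \sum_v (bc_polygon i v).-1)%N.
Proof.
move=> all_in npoly_gt1; rewrite exchange_big /=.
(* An arrow is a vertex with a position in its successor sequence, so loops are counted vertex by
   vertex. *)
transitivity (\sum_(v : bc_vertex C)
    #|[pred t | tnth (in_tuple (succ_seq v)) t == tnth (in_tuple (succ_seq v)) (ordS t)]|)%N.
  under [RHS]eq_bigr do rewrite -sum1_card.
  rewrite sig_big_dep /= -sum1_card.
  by apply: eq_bigl => -[v t].
pose i0 := Ordinal (ltnW npoly_gt1).
apply: eq_bigr => v _; rewrite (card_cyclic_repeat i0).
rewrite [last _ _](last_blocks (F := fun i => bc_polygon i v)) //.
rewrite [count _ _](count_repeat_blocks (F := fun i => bc_polygon i v)) ?big_enum //.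
by apply: path_last_neq; rewrite ?enum_uniq ?size_enum_ord.
Qed.

Theorem theorem3 (k : fieldType) (n m : nat) (K : m.-tuple 'I_n.+1)
    (x y : seq 'I_n.+1)
    (y_ciphertext : y = vigenere_encrypt K x)
    (y_freq : forall j : 'I_n.+1, (1 < count_mem j y)%N)
    (m_gt1 : (1 < m)%N)
    (y_lists : forall (i : 'I_m) (j : 'I_n.+1), j \in vigenere_list y i)
    (y_config : is_brauer_config (vigenere_config m y)) :
  exists d : nat,
    has_dim (V := brauer_algebra k (vigenere_config m y))
      (@in_center (brauer_algebra k (vigenere_config m y))) d /\
    d%:Z = 1 + m%:Z +
      \sum_(i < m) \sum_(j : 'I_n.+1) ((count_mem j (vigenere_list y i))%:Z - 1).
Proof.
have polyE (i : 'I_m) (j : 'I_n.+1) :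
    @bc_polygon (vigenere_config m y) i j = count_mem j (vigenere_list y i).
  exact: mset_seqE.
have all_in i v : (0 < @bc_polygon (vigenere_config m y) i v)%N.
  by rewrite polyE -has_count has_pred1.
exists (1 + (m + #|@loop (vigenere_config m y)|))%N; split.
  (* The letter [ord0] serves as the vertex whose special cycle connects the quiver. *)
  exact: (@has_dim_center k (vigenere_config m y) (fun=> erefl) all_in m_gt1 ord0).
rewrite card_loop // !PoszD addrA; congr (_ + _).
rewrite (big_morph Posz PoszD (erefl _)); apply: eq_bigr => i _.
rewrite (big_morph Posz PoszD (erefl _)); apply: eq_bigr => j _.
(* Every letter occurs in every list, so the natural predecessor is the integer difference. *)
by rewrite -polyE predn_int.
Qed.
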